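(* There exist constants $C,\gamma>0$, independent of $\epsilon$, $h$, and $\tau$, such that for every $0\le\epsilon\le1$, every solution $(p^\epsilon_{h,\tau},m^\epsilon_{h,\tau})$ of the discrete problem with parameter $\epsilon$, and the unique solution $(\bar p_h,\bar m_h)$ of the corresponding discrete stationary problem, there holds $$\|p^\epsilon_{h,\tau}(t^k)-\bar p_h\|^2+\epsilon^2\|m^\epsilon_{h,\tau}(t^k)-\bar m_h\|^2\le C e^{-\gamma(k-j)\tau}\Big(\|p^\epsilon_{h,\tau}(t^j)-\bar p_h\|^2+\epsilon^2\|m^\epsilon_{h,\tau}(t^j)-\bar m_h\|^2\Big)\qquad\text{for all }0\le j\le k.$$
   Context: Let $a:(0,1)\to\mathbb{R}$ be a fixed measurable function with $0<\underline a\le a(x)\le\overline a$ for constants $\underline a,\overline a$, let $g_0,g_1\in\mathbb{R}$ be fixed, and let the initial data $p_0,m_0\in H^1(0,1)$ satisfy $p_0(0)=g_0$, $p_0(1)=g_1$. $(\cdot,\cdot)$ and $\|\cdot\|$ denote the scalar product and norm of $L^2(0,1)$. Let $T_h=\{e\}$ be a uniform mesh of $(0,1)$ into elements (subintervals) $e$ of size $h$, and set $$Q_h=\{q\in L^2(0,1): q|_e\in P_0(e)\ \forall e\in T_h\},\qquad V_h=\{v\in C[0,1]: v|_e\in P_1(e)\ \forall e\in T_h\},$$ the spaces of piecewise constant and of continuous piecewise linear functions. Let $\tau>0$ be the time step, $t^k=k\tau$, and $\bar\partial_\tau u(t^k)=\frac1\tau[u(t^k)-u(t^{k-1})]$. Discrete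 problem with parameter $\epsilon\ge0$: let $p^\epsilon_{h,\tau}(0)\in Q_h$ and $m^\epsilon_{h,\tau}(0)\in V_h$ be the $L^2$-orthogonal projections of the initial data $p_0$, $m_0$ onto $Q_h$, $V_h$. For $k\ge1$ find $(p^\epsilon_{h,\tau}(t^k),m^\epsilon_{h,\tau}(t^k))\in Q_h\times V_h$ such that $$(\bar\partial_\tau p^\epsilon_{h,\tau}(t^k),q_h)+(\partial_x m^\epsilon_{h,\tau}(t^k),q_h)=0,$$ $$\epsilon^2(\bar\partial_\tau m^\epsilon_{h,\tau}(t^k),v_h)-(p^\epsilon_{h,\tau}(t^k),\partial_x v_h)+(a\,m^\epsilon_{h,\tau}(t^k),v_h)=g_0v_h(0)-g_1v_h(1)$$ for all $q_h\in Q_h$ and $v_h\in V_h$. This problem has a unique solution. Discrete stationary problem: find $(\bar p_h,\bar m_h)\in Q_h\times V_h$ with $(\partial_x\bar m_h,q_h)=0$ and $-(\bar p_h,\partial_x v_h)+(a\,\bar m_h,v_h)=g_0v_h(0)-g_1v_h(1)$ for all $q_h\in Q_h$, $v_h\in V_h$. It has a unique solution.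
   Formalization: The time step is restricted to 0 < τ ≤ τ₀ with τ₀ > 0 arbitrary, and C, γ may depend on τ₀; for unbounded τ the claim fails, since implicit Euler decays only rationally in τ (e.g. a = 1, zero boundary data, ε = 0, one element). *)

(* Defs.v *)
From mathcomp Require Export all_boot all_order all_algebra.
From mathcomp Require Export all_classical all_reals all_analysis.
Export Order.TTheory GRing.Theory Num.Theory.
Export numFieldNormedType.Exports.

Set Implicit Arguments.
Unset Strict Implicit.
Unset Printing Implicit Defensive.

Local Open Scope classical_set_scope.
Local Open Scope ring_scope.

(* Functions on the unit interval are represented by functions R -> R whose
   values outside [0, 1] are irrelevant; elements of L^2(0,1) are represented
   by functions, not by classes modulo a.e. equality. *)

Section L2.
Variable R : realType.
Implicit Types (u v w phi : R -> R).

Definition I01 : set R := `]0, 1[.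

Definition L2 u : Prop :=
  measurable_fun I01 u /\
  (@lebesgue_measure R).-integrable I01 (fun x => ((u x) ^+ 2)%:E).

Definition dot u v : R := \int[@lebesgue_measure R]_(x in I01) (u x * v x).

Definition L2norm u : R := Num.sqrt (dot u u).

(* phi \in C_c^\infty(0,1), extended by zero to R *)
Definition test_function phi : Prop :=
  (forall n x, derivable (derive1n n phi) x 1) /\
  (exists c d, [/\ 0 < c, d < 1 & forall x, x \notin `[c, d] -> phi x = 0]).

Definition weak_derivative u w : Prop :=
  forall phi, test_function phi -> dot u (derive1 phi) = - dot w phi.

(* u is the continuous representative on [0, 1] of an element of H^1(0,1), so
   that its boundary traces are the values u 0 and u 1. *)
Definition H1 u : Prop :=
  [/\ {within `[0, 1], continuous u}, L2 u &
      exists w, L2 w /\ weak_derivative u w].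

Definition L2_projection (W : (R -> R) -> Prop) u w : Prop :=
  W w /\ forall v, W v -> dot (fun x => u x - w x) v = 0.

End L2.

Section FiniteElements.
Variable R : realType.
Implicit Types (N : nat) (q v : R -> R).

Definition mesh_size N : R := N%:R^-1.

(* Elements are open, so the values of a piecewise polynomial at the mesh
   nodes, a null set, are left free unless continuity is required. *)
Definition element N (i : nat) : set R :=
  `]i%:R * mesh_size N, i.+1%:R * mesh_size N[.

Definition is_poly_on (d : nat) (e : set R) v : Prop :=
  exists r : {poly R}, (size r <= d.+1)%N /\ forall x, e x -> v x = r.[x].

Definition Qh N q : Prop :=
  L2 q /\ forall i, (i < N)%N -> is_poly_on 0 (element N i) q.

Definition Vh N v : Prop :=
  {within `[0, 1], continuous v} /\
  forall i, (i < N)%N -> is_poly_on 1 (element N i) v.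

End FiniteElements.

Section DiscreteProblems.
Variable R : realType.

Definition dtau (tau : R) (u : nat -> R -> R) (k : nat) : R -> R :=
  fun x => (u k x - u k.-1 x) / tau.

(* For v in Vh, derive1 v is the elementwise derivative, which is the weak
   derivative of v; its value at the nodes is irrelevant for the integrals. *)
Definition discrete_solution (a : R -> R) (g0 g1 : R) (p0 m0 : R -> R)
    (N : nat) (tau eps : R) (p m : nat -> R -> R) : Prop :=
  [/\ L2_projection (Qh N) p0 (p 0%N), L2_projection (Vh N) m0 (m 0%N) &
      forall k, (1 <= k)%N ->
      [/\ Qh N (p k), Vh N (m k),
          forall q, Qh N q ->
            dot (dtau tau p k) q + dot (derive1 (m k)) q = 0 &
          forall v, Vh N v ->
            eps ^+ 2 * dot (dtau tau m k) v - dot (p k) (derive1 v)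
              + dot (fun x => a x * m k x) v
            = g0 * v 0 - g1 * v 1]].

Definition discrete_stationary_solution (a : R -> R) (g0 g1 : R)
    (N : nat) (pbar mbar : R -> R) : Prop :=
  [/\ Qh N pbar, Vh N mbar,
      forall q, Qh N q -> dot (derive1 mbar) q = 0 &
      forall v, Vh N v ->
        - dot pbar (derive1 v) + dot (fun x => a x * mbar x) v
        = g0 * v 0 - g1 * v 1].

Definition error_energy (eps : R) (p m pbar mbar : R -> R) : R :=
  L2norm (fun x => p x - pbar x) ^+ 2
  + eps ^+ 2 * L2norm (fun x => m x - mbar x) ^+ 2.

End DiscreteProblems.

(* Main.v *)
Require Import Defs.
From mathcomp Require Import measurable_realfun ring lra.
Set Implicit Arguments.
Unset Strict Implicit.
Unset Printing Implicit Defensive.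
Local Open Scope classical_set_scope.
Local Open Scope ring_scope.

(** Let e^k and n^k be the errors in p and m at time t^k; they solve the
    discrete problem with homogeneous boundary data.  Testing with (e^k, n^k)
    gives the energy identity: ||e||^2 + eps^2 ||n||^2 decreases by
    2 tau (a n, n),
    and by the squared increments that the implicit Euler scheme dissipates.
    Neither term controls e itself, so the identity does not yield decay alone.

    The missing control comes from a discrete inf-sup argument.  For e in Q_h
    let w be the function in V_h of mean zero with derivative e ([antideriv]).
    Then ||w|| <= ||e|| ([antideriv_norm_le]), and testing the second equation
    with w^k gives
      ||e^k||^2 = eps^2 (dtau n^k, w^k) + (a n^k, w^k).
    The first equation says that the increments of e are - tau times the
    derivative of n; hence (w^k - w^(k-1)) / tau is minus the mean-zero
    antiderivative of the derivative of n^k, that is, n^k up to sign and a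
    constant, and its norm is at most ||n^k|| ([antideriv_slopes_le]).
    Summation by parts in time thus turns (dtau n^k, w^k) into the time
    difference of (n, w) plus terms controlled by ||n^k||^2 and
    ||n^k - n^(k-1)||^2.

    Consequently, for small delta, the functional
      energy / 2 - delta eps^2 (n, w)
    is equivalent to the energy ([lyapunov_equiv]) and contracts by a factor
    1 / (1 + 2/3 delta tau) in each step ([lyapunov_decrease]).  The bound
    tau <= tau0 serves twice: it lets the numerical dissipation absorb the
    increments of n, and it bounds the contraction factor by
    exp(- gamma tau) with gamma independent of tau
    ([implicit_euler_decay]). *)

(** * The scalar product on bounded measurable functions *)

Section BoundedMeasurable.
Variable R : realType.
Implicit Types (u v w : R -> R) (k : R).

(** On the unit interval this class lies in L^2 and is closed under products,
    so that every scalar product of its members is the integral of an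
    integrable function. *)
Definition bounded_measurable u : Prop :=
  measurable_fun (@I01 R) u /\ exists M, forall x, I01 x -> `|u x| <= M.

Lemma measurable_I01 : measurable (@I01 R).
Proof. exact: measurable_itv. Qed.

#[local] Hint Resolve measurable_I01 : core.

Lemma lebesgue_I01 : lebesgue_measure (@I01 R) = 1%E.
Proof.
by rewrite /I01 lebesgue_measure_itv/= lte_fin ltr01 -EFinD subr0.
Qed.

Lemma bounded_measurable_cst k : bounded_measurable (fun=> k).
Proof. by split; [exact: measurable_cst|exists `|k|]. Qed.

Lemma bounded_measurableD u v : bounded_measurable u -> bounded_measurable v ->
  bounded_measurable (fun x => u x + v x).
Proof.
move=> [mu [M uM]] [mv [K vK]]; split; first exact: measurable_funD.
exists (M + K) => x xI; apply: le_trans (ler_normD _ _) _.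
by apply: lerD; [exact: uM|exact: vK].
Qed.

Lemma bounded_measurableM u v : bounded_measurable u -> bounded_measurable v ->
  bounded_measurable (fun x => u x * v x).
Proof.
move=> [mu [M uM]] [mv [K vK]]; split; first exact: measurable_funM.
exists (M * K) => x xI; rewrite normrM.
by apply: ler_pM => //; [exact: uM|exact: vK].
Qed.

Lemma bounded_measurableZ k u : bounded_measurable u ->
  bounded_measurable (fun x => k * u x).
Proof. exact: bounded_measurableM (bounded_measurable_cst k). Qed.

Lemma bounded_measurableB u v : bounded_measurable u -> bounded_measurable v ->
  bounded_measurable (fun x => u x - v x).
Proof.
move=> bu bv; have := bounded_measurableD bu (bounded_measurableZ (-1) bv).
by congr bounded_measurable; apply/funext => x; rewrite mulN1r.
Qed.

Lemma continuous_bounded_measurable u : {within `[0, 1], continuous u} ->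
  bounded_measurable u.
Proof.
move=> cu; split.
  apply: (@measurable_funS _ _ _ _ (`[0, 1] : set R)) => //.
    exact: subset_itv_oo_cc.
  exact: subspace_continuous_measurable_fun.
have [c _ cP] := EVT_max ler01 cu; have [d _ dP] := EVT_min ler01 cu.
exists (`|u c| + `|u d|) => x /subset_itv_oo_cc xI.
have /cP uc : x \in `[0, 1] by [].
have /dP ud : x \in `[0, 1] by [].
rewrite ler_norml; apply/andP; split.
  by have := ler_norm (- u d); have := normr_ge0 (u c); rewrite normrN; lra.
by have := ler_norm (u c); have := normr_ge0 (u d); lra.
Qed.

Lemma bounded_measurable_integrable u : bounded_measurable u ->
  (@lebesgue_measure R).-integrable (@I01 R) (EFin \o u).
Proof.
move=> [mu [M uM]]; apply: measurable_bounded_integrable => //.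
  by rewrite -[X in (X < _)%E]/(lebesgue_measure _) lebesgue_I01 ltry.
exists M; split; first exact: num_real.
by move=> y My x /uM uMx; apply: le_trans uMx (ltW My).
Qed.

Lemma dotC u v : dot u v = dot v u.
Proof. by apply: eq_Rintegral => x _; rewrite mulrC. Qed.

Lemma eq_dot u u' v v' : (forall x, I01 x -> u x = u' x) ->
  (forall x, I01 x -> v x = v' x) -> dot u v = dot u' v'.
Proof.
by move=> uu vv; apply: eq_Rintegral => x; rewrite inE => xI; rewrite uu ?vv.
Qed.

Lemma dotDl u v w : bounded_measurable u -> bounded_measurable v ->
  bounded_measurable w -> dot (fun x => u x + v x) w = dot u w + dot v w.
Proof.
move=> bu bv bw; rewrite /dot -RintegralD//.
- by apply: eq_Rintegral => x _; rewrite mulrDl.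
- exact/bounded_measurable_integrable/bounded_measurableM.
- exact/bounded_measurable_integrable/bounded_measurableM.
Qed.

Lemma dotZl k u w : bounded_measurable u -> bounded_measurable w ->
  dot (fun x => k * u x) w = k * dot u w.
Proof.
move=> bu bw; rewrite /dot -RintegralZl//.
- by apply: eq_Rintegral => x _; rewrite mulrA.
- exact/bounded_measurable_integrable/bounded_measurableM.
Qed.

Lemma dotBl u v w : bounded_measurable u -> bounded_measurable v ->
  bounded_measurable w -> dot (fun x => u x - v x) w = dot u w - dot v w.
Proof.
move=> bu bv bw; rewrite -mulN1r -dotZl// -dotDl//.
  by apply: eq_dot => // x _; rewrite mulN1r.
exact: bounded_measurableZ.
Qed.

Lemma dotBr u v w : bounded_measurable u -> bounded_measurable v ->
  bounded_measurable w -> dot w (fun x => u x - v x) = dot w u - dot w v.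
Proof. by move=> *; rewrite dotC dotBl// !(dotC w). Qed.

Lemma dotZr k u w : bounded_measurable u -> bounded_measurable w ->
  dot w (fun x => k * u x) = k * dot w u.
Proof. by move=> *; rewrite dotC dotZl// (dotC w). Qed.

Lemma dot_ge0 u : 0 <= dot u u.
Proof. by apply: Rintegral_ge0 => x _; rewrite -expr2 sqr_ge0. Qed.

Lemma dot_cst k l : dot (fun=> k) (fun=> l) = k * l :> R.
Proof.
rewrite /dot Rintegral_cst// -[X in fine X]/(lebesgue_measure _) lebesgue_I01.
by rewrite mulr1.
Qed.

Lemma le_dot u v : bounded_measurable u -> bounded_measurable v ->
  (forall x, I01 x -> u x ^+ 2 <= v x ^+ 2) -> dot u u <= dot v v.
Proof.
move=> bu bv uv; apply: le_Rintegral => //.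
- exact/bounded_measurable_integrable/bounded_measurableM.
- exact/bounded_measurable_integrable/bounded_measurableM.
Qed.

Lemma dot_sub_sqr u v : bounded_measurable u -> bounded_measurable v ->
  dot (fun x => u x - v x) (fun x => u x - v x)
  = dot u u - 2 * dot u v + dot v v.
Proof.
move=> bu bv; rewrite dotBl ?dotBr//; last exact: bounded_measurableB.
by rewrite (dotC v u); ring.
Qed.

Lemma dot_young u v : bounded_measurable u -> bounded_measurable v ->
  2 * dot u v <= dot u u + dot v v.
Proof.
move=> bu bv; have := dot_ge0 (fun x => u x - v x).
by rewrite dot_sub_sqr//; lra.
Qed.

Lemma dot_youngN u v : bounded_measurable u -> bounded_measurable v ->
  - (dot u u + dot v v) <= 2 * dot u v.
Proof.
move=> bu bv; have := dot_ge0 (fun x => u x - -1 * v x).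
rewrite dot_sub_sqr//; last exact: bounded_measurableZ.
by rewrite !dotZr ?dotZl//; try exact: bounded_measurableZ; lra.
Qed.

(** Bounds a product in which v stands for the previous time step and u for the
    current one: the dissipation controls u only, and the increment u - v
    separately. *)
Lemma dot_young_shift u v w : bounded_measurable u -> bounded_measurable v ->
  bounded_measurable w ->
  2 * dot v w
  <= dot u u + 2 * dot w w + dot (fun x => u x - v x) (fun x => u x - v x).
Proof.
move=> bu bv bw; have := dot_youngN (bounded_measurableB bu bv) bw.
by have := dot_young bu bw; rewrite (dotBl bu bv bw); lra.
Qed.

Lemma L2norm_sqr u : L2norm u ^+ 2 = dot u u.
Proof. by rewrite sqr_sqrtr// dot_ge0. Qed.

End BoundedMeasurable.

(** * Piecewise constant functions *)

Section PiecewiseConstant.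
Variables (R : realType) (N : nat).
Hypothesis N_gt0 : (0 < N)%N.
Local Notation h := (mesh_size R N).
Implicit Types (f g q : R -> R) (c d : nat -> R).

Definition piecewise_const c f : Prop :=
  forall i x, (i < N)%N -> element N i x -> f x = c i.

Lemma mesh_size_gt0 : 0 < h.
Proof. by rewrite /mesh_size invr_gt0 ltr0n. Qed.

Lemma mesh_sizeE : N%:R * h = 1.
Proof. by rewrite divff// pnatr_eq0 -lt0n. Qed.

Lemma nodeS i : i.+1%:R * h = i%:R * h + h.
Proof. by rewrite -natr1; ring. Qed.

(** Measurability is part of the conclusion: off the nodes, which are finitely
    many, f is a step function, and its values at the nodes are arbitrary. *)
Lemma piecewise_const_integral c f : piecewise_const c f ->
  bounded_measurable f /\
  \int[@lebesgue_measure R]_(x in @I01 R) f x = h * \sum_(i < N) c i.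
Proof.
move=> fc; have h0 := mesh_size_gt0.
have node0 n : 0 <= n%:R * h by rewrite mulr_ge0// ltW.
(* Half-open cells tile the interval without exceptional points. *)
have split n : (`]0, n.+1%:R * h] =
    `]0, n%:R * h] `|` `]n%:R * h, n.+1%:R * h])%classic.
  apply: itv_bndbnd_setU; rewrite bnd_simp// nodeS.
  by rewrite lerDl ltW.
have bf n : (n <= N)%N -> measurable_fun `]0, n%:R * h]%classic f /\
    exists M, forall x, x \in `]0, n%:R * h]%R -> `|f x| <= M.
  elim: n => [_|n IH nN].
    rewrite mul0r set_itv_ge ?bnd_simp ?ltxx//.
    split; first exact: measurable_fun_set0.
    by exists 0 => x; rewrite itv_ge ?bnd_simp ?ltxx.
  have [mf [M fM]] := IH (ltnW nN); split.
    rewrite split; apply/measurable_funU => //; split=> //.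
    apply/measurable_fun_itv_bndo_bndcP.
    apply: (eq_measurable_fun (cst (c n))); last exact: measurable_cst.
    by move=> x; rewrite inE => /fc ->.
  exists (Num.max M (Num.max `|c n| `|f (n.+1%:R * h)|)) => x.
  rewrite in_itv/= => /andP[x0]; rewrite le_eqVlt => /orP[/eqP ->|xn1].
    by rewrite !le_max lexx !orbT.
  have [xn|xn] := leP x (n%:R * h).
    by rewrite le_max fM// in_itv/= x0.
  by rewrite (fc n)// ?le_max ?lexx ?orbT// /element/= in_itv/= xn.
have bI (x : R) : I01 x -> x \in `]0, N%:R * h]%R.
  by rewrite /I01/= mesh_sizeE !in_itv/= => /andP[-> /ltW].
have [mf [M fM]] := bf N (leqnn N).
have bmf : bounded_measurable f.
  split; last by exists M => x /bI; exact: fM.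
  by apply: measurable_funS mf => //; move=> x /bI.
split=> //.
have intf n : (n <= N)%N ->
    lebesgue_measure.-integrable `]0, n%:R * h]%classic (EFin \o f).
  move=> /bf[mfn [K fK]]; apply: measurable_bounded_integrable => //.
    rewrite -[X in (X < _)%E]/(lebesgue_measure _) lebesgue_measure_itv/=.
    by case: ifP => _; rewrite -?EFinD ltry.
  exists K; split; first exact: num_real.
  by move=> y Ky x /fK fx; apply: le_trans fx (ltW Ky).
suff /(_ N (leqnn N)) : forall n, (n <= N)%N ->
    \int[@lebesgue_measure R]_(x in `]0, n%:R * h]%classic) f x
    = h * \sum_(i < n) c i.
  move=> <-; rewrite mesh_sizeE /I01; apply/esym.
  rewrite -Rintegral_itv_bndo_bndc//.
  exact: bounded_measurable_integrable.
elim=> [_|n IH nN].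
  by rewrite mul0r set_itv_ge ?bnd_simp ?ltxx// Rintegral_set0 big_ord0 mulr0.
rewrite big_ord_recr/= mulrDr -IH ?(ltnW nN)//.
apply/eqP; rewrite addrC -subr_eq; apply/eqP.
rewrite Rintegral_itvB ?bnd_simp//; first last.
- by rewrite nodeS lerDl ltW.
- exact: intf.
rewrite -Rintegral_itv_bndo_bndc//; last first.
  apply: integrableS (intf _ nN) => //.
  move=> x; rewrite /= !in_itv/= => /andP[xn /ltW ->].
  by rewrite (le_lt_trans _ xn).
rewrite (@eq_Rintegral _ _ _ _ _ (cst (c n))); last first.
  by move=> x; rewrite inE => /fc ->.
rewrite Rintegral_cst// -[X in fine X]/(lebesgue_measure _).
rewrite lebesgue_measure_itv/= lte_fin.
have nh : n%:R * h < n.+1%:R * h by rewrite nodeS ltrDl.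
by rewrite nh -EFinD/= nodeS mulrC; congr (_ * _); ring.
Qed.

Lemma piecewise_const_dot c d f g : piecewise_const c f ->
  piecewise_const d g -> dot f g = h * \sum_(i < N) c i * d i.
Proof.
move=> fc gd.
have fgcd : piecewise_const (fun i => c i * d i) (fun x => f x * g x).
  by move=> i x iN xi; rewrite (fc i)// (gd i).
by have [_] := piecewise_const_integral fgcd; apply.
Qed.

Lemma Qh_piecewise_const q : Qh N q -> exists c, piecewise_const c q.
Proof.
move=> [_ qN].
have /choice[c cP] (i : nat) :
    exists ci, (i < N)%N -> forall x, element N i x -> q x = ci.
  case: (ltnP i N) => [iN|]; last by exists 0.
  have [r [/size1_polyC -> qr]] := qN i iN.
  by exists r`_0 => _ x /qr; rewrite hornerC.
by exists c => i x iN; exact: cP.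
Qed.

Lemma piecewise_const_Qh c q : piecewise_const c q -> Qh N q.
Proof.
move=> qc; have [bq _] := piecewise_const_integral qc; split.
  split; first by case: bq.
  by apply: bounded_measurable_integrable; exact: bounded_measurableM.
move=> i iN; exists (c i)%:P; split; first by rewrite size_polyC leq_b1.
by move=> x xi; rewrite hornerC (qc i).
Qed.

End PiecewiseConstant.

(** * Piecewise affine functions and their slopes *)

Section PiecewiseAffine.
Variables (R : realType) (N : nat).
Implicit Types (u v : R -> R) (c d s : nat -> R).

(** Records the elementwise derivative of v as a sequence of numbers, so that
    linear combinations act on slopes without differentiating. *)
Definition has_slopes s v : Prop :=
  forall i, (i < N)%N -> exists b, forall x, element N i x -> v x = b + s i * x.

Lemma Vh_slopes v : Vh N v -> exists s, has_slopes s v.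
Proof.
move=> [_ vN].
have /choice[s sP] (i : nat) : exists si, (i < N)%N ->
    exists b, forall x, element N i x -> v x = b + si * x.
  case: (ltnP i N) => [iN|]; last by exists 0.
  have [r [sr vr]] := vN i iN.
  exists r`_1 => _; exists r`_0 => x /vr ->.
  by rewrite (horner_coef_wide _ sr) big_ord_recr big_ord1/= expr0 mulr1 expr1.
by exists s.
Qed.

Lemma slopes_Vh s v :
  {within `[0, 1], continuous v} -> has_slopes s v -> Vh N v.
Proof.
move=> cv vs; split=> // i /vs[b vb].
exists (b%:P + (s i)%:P * 'X); split.
  rewrite (leq_trans (size_polyD _ _))// geq_max.
  rewrite (leq_trans (size_polyC_leq1 _))//.
  by rewrite mul_polyC (leq_trans (size_scale_leq _ _))// size_polyX.
by move=> x /vb; rewrite hornerD hornerM !hornerC hornerX.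
Qed.

Lemma has_slopesB s t u v : has_slopes s u -> has_slopes t v ->
  has_slopes (fun i => s i - t i) (fun x => u x - v x).
Proof.
move=> us vt i iN; have [b ub] := us i iN; have [e ve] := vt i iN.
by exists (b - e) => x xi; rewrite ub// ve//; ring.
Qed.

Lemma Vh_bounded_measurable v : Vh N v -> bounded_measurable v.
Proof. by case=> cv _; exact: continuous_bounded_measurable. Qed.

Lemma VhB u v : Vh N u -> Vh N v -> Vh N (fun x => u x - v x).
Proof.
move=> Vu Vv; have [s us] := Vh_slopes Vu; have [t vt] := Vh_slopes Vv.
apply: slopes_Vh (has_slopesB us vt).
by case: Vu => cu _; case: Vv => cv _; exact: within_continuousB.
Qed.

Lemma has_slopes_is_derive s v i x : has_slopes s v -> (i < N)%N ->
  element N i x -> is_derive x 1 v (s i).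
Proof.
move=> vs iN xi; have [b vb] := vs i iN.
have <- : (deriv (b%:P + (s i)%:P * 'X)).[x] = s i.
  by rewrite derivD derivM !derivC derivX !hornerE.
apply: near_eq_is_derive (is_derive_poly _ x).
near=> y; rewrite vb ?hornerE//.
by near: y; exact: near_in_itvoo.
Unshelve. all: by end_near.
Qed.

Lemma has_slopes_derive1 s v : has_slopes s v ->
  piecewise_const N s (derive1 v).
Proof.
move=> vs i x iN xi; rewrite derive1E.
by have /@derive_val := has_slopes_is_derive vs iN xi.
Qed.

End PiecewiseAffine.

(** * Discrete antiderivatives of mean zero *)

Section Spline.
Variables (R : realType) (N : nat).
Hypothesis N_gt0 : (0 < N)%N.
Local Notation h := (mesh_size R N).
Implicit Types (u v : R -> R) (c d s : nat -> R).

(** The continuous function that vanishes left of element i, has slope 1 on it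
    and stays constant to its right. *)
Definition ramp (i : nat) (x : R) : R :=
  Num.min x (i.+1%:R * h) - Num.min x (i%:R * h).

Definition spline c (x : R) : R := \sum_(i < N) c i * ramp i x.

Lemma ler_node i j : (i <= j)%N -> i%:R * h <= j%:R * h.
Proof. by move=> ij; rewrite ler_wpM2r ?ler_nat// ltW// mesh_size_gt0. Qed.

Lemma ramp_left i x : x <= i%:R * h -> ramp i x = 0.
Proof.
move=> xi; rewrite /ramp !min_l ?subrr//.
exact: le_trans xi (ler_node (leqnSn i)).
Qed.

Lemma ramp_right i x : i.+1%:R * h <= x -> ramp i x = h.
Proof.
move=> ix; rewrite /ramp !min_r//; first by rewrite nodeS; ring.
exact: le_trans (ler_node (leqnSn i)) ix.
Qed.

Lemma ramp_mid i x : i%:R * h <= x <= i.+1%:R * h -> ramp i x = x - i%:R * h.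
Proof. by move=> /andP[ix xi]; rewrite /ramp min_l// min_r. Qed.

Lemma ramp_bounds i x : 0 <= ramp i x <= h.
Proof.
have h0 : 0 <= h by rewrite ltW// mesh_size_gt0.
have [xi|ix] := leP x (i%:R * h); first by rewrite ramp_left// lexx h0.
have [xi|xi] := leP x (i.+1%:R * h).
  by rewrite ramp_mid ?(ltW ix)//; move: xi ix; rewrite nodeS; lra.
by rewrite ramp_right ?(ltW xi)// lexx h0.
Qed.

Lemma continuous_ramp i : continuous (ramp i).
Proof.
have cmin (k : R) : continuous (fun x : R => Num.min x k : R^o).
  move=> x; apply: (@continuous_min _ _ (id : R -> R^o) (cst k)).
    exact: cvg_id.
  exact: cvg_cst.
move=> x; rewrite /continuous_at /ramp.
by apply: cvgB; exact: cmin.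
Qed.

Lemma continuous_spline c : continuous (spline c).
Proof.
have -> : spline c = \sum_(i < N) (fun x => c i * ramp i x).
  by apply/funext => x; rewrite fct_sumE.
move=> x; elim/big_ind: _ => [|u v cu cv|i _].
- exact: cvg_cst.
- exact: continuousD.
- by apply: continuousM; [exact: cvg_cst|exact: continuous_ramp].
Qed.

Lemma spline_slopes c : has_slopes N c (spline c).
Proof.
move=> i iN.
exists (\sum_(j < N) (if (j < i)%N then c j * h else 0)
  - c i * (i%:R * h)) => x.
rewrite /element/= in_itv/= => /andP[ix xi].
have -> : c i * x = \sum_(j < N) (if j == Ordinal iN then c i * x else 0).
  by rewrite -big_mkcond big_pred1_eq.
have -> : c i * (i%:R * h) =
    \sum_(j < N) (if j == Ordinal iN then c i * (i%:R * h) else 0).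
  by rewrite -big_mkcond big_pred1_eq.
rewrite -sumrB -big_split/=; apply: eq_bigr => j _.
have [ji|ij|ji] := ltngtP j i.
- have -> : (j == Ordinal iN) = false.
    by apply/eqP => E; move: ji; rewrite E ltnn.
  rewrite ramp_right ?subr0 ?addr0//.
  exact: le_trans (ler_node ji) (ltW ix).
- have -> : (j == Ordinal iN) = false.
    by apply/eqP => E; move: ij; rewrite E ltnn.
  rewrite ramp_left ?subr0 ?addr0 ?mulr0//.
  exact: le_trans (ltW xi) (ler_node ij).
- have -> : j == Ordinal iN by apply/eqP/val_inj.
  by rewrite ramp_mid ji ?ltW//; ring.
Qed.

Lemma spline_comb k s c d : (forall i, (i < N)%N -> c i - d i = k * s i) ->
  forall x, spline c x - spline d x = k * spline s x.
Proof.
move=> cds x; rewrite /spline mulr_sumr -sumrB; apply: eq_bigr => i _.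
by rewrite mulrA -cds//; ring.
Qed.

(** The Poincare bound, which replaces |int_0^x q| <= ||q||.  With t the value
    of the spline at x, expand 2 t^2 = sum 2 c_i ramp_i t and bound each term
    by h (c_i^2 + t^2); as N h = 1, the t^2 on the right add up to a single
    one, which is absorbed on the left. *)
Lemma spline_sqr_le c x : spline c x ^+ 2 <= h * \sum_(i < N) c i ^+ 2.
Proof.
set t := spline c x.
have tt : 2 * (t * t) <= h * \sum_(i < N) c i ^+ 2 + t ^+ 2.
  have -> : t ^+ 2 = h * \sum_(i < N) t ^+ 2.
    rewrite sumr_const card_ord -mulr_natr mulrA [h * _]mulrC -mulrA.
    by rewrite [h * _]mulrC mesh_sizeE// mulr1.
  rewrite -mulrDr -big_split/= {2}/t /spline mulr_sumr !mulr_sumr.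
  apply: ler_sum => i _.
  have /andP[r0 rh] := ramp_bounds i x.
  have c2 : 0 <= c i ^+ 2 + t ^+ 2 by rewrite addr_ge0 ?sqr_ge0.
  apply: le_trans (ler_wpM2r c2 rh).
  have := mulr_ge0 r0 (sqr_ge0 (c i - t)); nra.
by move: tt; rewrite -expr2; lra.
Qed.

(** A continuous function is determined by its slopes and its value at 0:
    the mean value theorem gives the increment over each closed element, the
    boundary nodes being reached by continuity. *)
Lemma spline_rep s v : {within `[0, 1], continuous v} -> has_slopes N s v ->
  forall x, x \in `[0, 1] -> v x = v 0 + spline s x.
Proof.
move=> cv vs.
have h0 : 0 <= h by rewrite ltW// mesh_size_gt0.
have node0 i : 0 <= i%:R * h by rewrite mulr_ge0.
have node1 i : (i <= N)%N -> i%:R * h <= 1.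
  by move=> /ler_node; rewrite mesh_sizeE.
have step i x : (i < N)%N -> i%:R * h <= x <= i.+1%:R * h ->
    v x = v (i%:R * h) + s i * (x - i%:R * h).
  move=> iN /andP[ix xi].
  have [||e _ E] := @MVT_segment _ v (fun=> s i) _ _ ix.
  - move=> y; rewrite in_itv/= => /andP[iy yx].
    apply: has_slopes_is_derive vs iN _.
    by rewrite /element/= in_itv/= iy (lt_le_trans yx).
  - apply: continuous_subspaceW cv => y; rewrite /= !in_itv/= => /andP[iy yx].
    by rewrite (le_trans (node0 i) iy)/= (le_trans yx)// (le_trans xi)// node1.
  by rewrite -E addrC subrK.
suff main n : (n <= N)%N -> forall x, 0 <= x <= n%:R * h ->
    v x = v 0 + \sum_(i < n) s i * ramp i x.
  move=> x; rewrite in_itv/= => x01; apply: main => //.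
  by rewrite mesh_sizeE.
elim: n => [_ x|n IH nN x /andP[x0 xn1]].
  by rewrite mul0r big_ord0 addr0 => x0; congr v; lra.
rewrite big_ord_recr/=; have [xn|nx] := leP x (n%:R * h).
  by rewrite ramp_left// mulr0 addr0; apply: IH; rewrite ?x0//; exact: ltnW.
rewrite (step n)// ?xn1 ?ltW// ramp_mid ?xn1 ?ltW//.
rewrite IH ?node0 ?lexx//; last exact: ltnW.
rewrite addrA; congr (_ + _ + _); apply: eq_bigr => i _.
by rewrite !ramp_right ?ler_node// (le_trans (ler_node (ltn_ord i)))// ltW.
Qed.

Lemma bounded_measurable_spline c : bounded_measurable (spline c).
Proof.
by apply: continuous_bounded_measurable; apply: continuous_subspaceT;
  exact: continuous_spline.
Qed.

(** The member of V_h with slopes c and mean zero.  The normalisation by the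
    mean, instead of by the value at 0, makes it the smallest in norm among
    all members of V_h with these slopes; the value at 0 of a function is not
    bounded by its norm uniformly in h. *)
Definition antideriv c (x : R) : R := spline c x - dot (spline c) (fun=> 1).

Lemma continuous_antideriv c : continuous (antideriv c).
Proof.
by move=> x; apply: cvgB; [exact: continuous_spline|exact: cvg_cst].
Qed.

Lemma bounded_measurable_antideriv c : bounded_measurable (antideriv c).
Proof.
apply: bounded_measurableB; first exact: bounded_measurable_spline.
exact: bounded_measurable_cst.
Qed.

Lemma antideriv_slopes c : has_slopes N c (antideriv c).
Proof.
move=> i /(spline_slopes c)[b cb].
exists (b - dot (spline c) (fun=> 1)) => x xi.
by rewrite /antideriv cb//; ring.
Qed.

Lemma Vh_antideriv c : Vh N (antideriv c).
Proof.
apply: slopes_Vh (@antideriv_slopes c); apply: continuous_subspaceT.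
exact: continuous_antideriv.
Qed.

Lemma antideriv_mean0 c : dot (antideriv c) (fun=> 1) = 0.
Proof.
have b1 := bounded_measurable_cst (1 : R).
rewrite dotBl//; last first.
- exact: bounded_measurable_cst.
- exact: bounded_measurable_spline.
by rewrite dot_cst mulr1 subrr.
Qed.

Lemma antideriv_comb k s c d : (forall i, (i < N)%N -> c i - d i = k * s i) ->
  forall x, antideriv c x - antideriv d x = k * antideriv s x.
Proof.
move=> cds x; have bs := bounded_measurable_spline.
have b1 := bounded_measurable_cst (1 : R).
have E : k * dot (spline s) (fun=> 1) =
    dot (spline c) (fun=> 1) - dot (spline d) (fun=> 1).
  rewrite -dotZl// -dotBl//; apply: eq_dot => // y _.
  by rewrite (spline_comb cds).
by rewrite /antideriv mulrBr E -(spline_comb cds); ring.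
Qed.

(** Pythagoras: a function of mean zero is orthogonal to the constants. *)
Lemma dot_shift k u v : bounded_measurable u -> dot u (fun=> 1) = 0 ->
  (forall x, I01 x -> v x = u x + k) -> dot u u <= dot v v.
Proof.
move=> bu u0 vu; have b1 := bounded_measurable_cst (1 : R).
have bk := bounded_measurable_cst k.
have bw := bounded_measurableD bu bk.
have uk : dot u (fun=> k) = 0.
  rewrite -(mulr0 k) -u0 -dotZr//; apply: eq_dot => // x _.
  by rewrite mulr1.
rewrite (eq_dot vu vu) dotDl// !(dotC _ (fun x => u x + k)) !dotDl//.
rewrite dot_cst (dotC _ u) uk.
have := sqr_ge0 k; nra.
Qed.

Lemma antideriv_norm_le c :
  dot (antideriv c) (antideriv c) <= h * \sum_(i < N) c i ^+ 2.
Proof.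
have h0 : 0 <= h by rewrite ltW// mesh_size_gt0.
apply: (@le_trans _ _ (dot (spline c) (spline c))).
  apply: (@dot_shift (dot (spline c) (fun=> 1))).
  - exact: bounded_measurable_antideriv.
  - exact: antideriv_mean0.
  - by move=> x _; rewrite subrK.
pose K := h * \sum_(i < N) c i ^+ 2.
have K0 : 0 <= K by rewrite mulr_ge0// sumr_ge0// => i _; exact: sqr_ge0.
have bK := bounded_measurable_cst (Num.sqrt K).
apply: (@le_trans _ _ (dot (fun=> Num.sqrt K) (fun=> Num.sqrt K))).
  apply: le_dot => //; first exact: bounded_measurable_spline.
  by move=> x _; rewrite sqr_sqrtr// spline_sqr_le.
by rewrite dot_cst -expr2 sqr_sqrtr.
Qed.

(** Recovering v from its derivative loses only the mean, hence does not
    increase the norm. *)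
Lemma antideriv_slopes_le s v : Vh N v -> has_slopes N s v ->
  dot (antideriv s) (antideriv s) <= dot v v.
Proof.
move=> [cv _] vs.
apply: (@dot_shift (v 0 + dot (spline s) (fun=> 1))).
- exact: bounded_measurable_antideriv.
- exact: antideriv_mean0.
- move=> x /subset_itv_oo_cc xI; rewrite (spline_rep cv vs) ?inE//.
  by rewrite /antideriv; ring.
Qed.

End Spline.

(** * Equations satisfied by the error *)

Section ErrorEquations.
Variables (R : realType) (a : R -> R) (alo ahi : R).
Hypothesis a_meas : measurable_fun (@I01 R) a.
Hypothesis alo_gt0 : 0 < alo.
Hypothesis a_bounds : forall x : R, @I01 R x -> alo <= a x <= ahi.

Lemma bounded_measurable_coef : bounded_measurable a.
Proof.
split=> //; exists ahi => x /a_bounds/andP[a0 a1].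
by rewrite ger0_norm// (le_trans _ a0)// ltW.
Qed.

Lemma coef_dot_ge n : bounded_measurable n ->
  alo * dot n n <= dot (fun x => a x * n x) n.
Proof.
move=> bn; have ban := bounded_measurableM bounded_measurable_coef bn.
rewrite -dotZl//; apply: le_Rintegral.
- exact: measurable_I01.
- apply/bounded_measurable_integrable/bounded_measurableM => //.
  exact: bounded_measurableZ.
- exact/bounded_measurable_integrable/bounded_measurableM.
- move=> x /a_bounds/andP[ax _].
  by rewrite -!mulrA; apply: ler_wpM2r; rewrite // -expr2 sqr_ge0.
Qed.

Lemma coef_dot_le n : bounded_measurable n ->
  dot (fun x => a x * n x) (fun x => a x * n x) <= ahi ^+ 2 * dot n n.
Proof.
move=> bn; have ban := bounded_measurableM bounded_measurable_coef bn.
have bhn := bounded_measurableZ ahi bn.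
rewrite expr2 -mulrA -dotZr// -dotZl//.
apply: le_dot => // x /a_bounds/andP[a0 a1].
rewrite !exprMn ler_wpM2r ?sqr_ge0// ler_sqr ?nnegrE//.
  by apply: le_trans a0; exact: ltW.
by apply: le_trans (le_trans a0 a1); exact: ltW.
Qed.

Variables (g0 g1 : R) (p0 m0 : R -> R) (N : nat) (tau eps : R).
Variables (p m : nat -> R -> R) (pbar mbar : R -> R).
Hypothesis N_gt0 : (0 < N)%N.
Hypothesis tau_gt0 : 0 < tau.
Hypothesis sol : discrete_solution a g0 g1 p0 m0 N tau eps p m.
Hypothesis stat : discrete_stationary_solution a g0 g1 N pbar mbar.
Local Notation h := (mesh_size R N).
Local Notation e k := (fun x => p k x - pbar x).
Local Notation n k := (fun x => m k x - mbar x).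

Lemma discrete_solution_Qh k : Qh N (p k).
Proof.
case: sol => -[Qp0 _] _ eqs.
by case: k => [|k]//; case: (eqs k.+1).
Qed.

Lemma discrete_solution_Vh k : Vh N (m k).
Proof.
case: sol => _ [Vm0 _] eqs.
by case: k => [|k]//; case: (eqs k.+1).
Qed.

(** The derivative of mbar is itself an admissible test function. *)
Lemma stationary_slopes s : has_slopes N s mbar ->
  forall i, (i < N)%N -> s i = 0.
Proof.
move=> ms; case: stat => _ _ eqq _.
have dm := has_slopes_derive1 ms.
have := eqq _ (piecewise_const_Qh N_gt0 dm).
rewrite (piecewise_const_dot N_gt0 dm dm) => /eqP.
rewrite mulf_eq0 gt_eqF ?mesh_size_gt0//= psumr_eq0; last first.
  by move=> i _; rewrite -expr2 sqr_ge0.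
move=> /allP s0 i iN; have := s0 (Ordinal iN).
rewrite mem_index_enum => /(_ isT).
by rewrite /= mulf_eq0 orbb => /eqP.
Qed.

(** The boundary data cancel in the difference of the two problems.  Testing
    the balance equation with its own residual turns it into a pointwise
    identity between the increments of the coefficients of p and the slopes of
    m; the second equation stays in weak form, multiplied by tau. *)
Lemma error_equations : exists c : nat -> nat -> R,
  [/\ forall k, piecewise_const N (c k) (e k),
      forall k, exists2 s, has_slopes N s (n k.+1) &
        forall i, (i < N)%N -> c k.+1 i - c k i = - tau * s i &
      forall k v t, Vh N v -> has_slopes N t v ->
        eps ^+ 2 * (dot (n k.+1) v - dot (n k) v)
        - tau * (h * \sum_(i < N) c k.+1 i * t i)
        + tau * dot (fun x => a x * n k.+1 x) v = 0].
Proof.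
have [Qpbar Vmbar _ statv] := stat; have [_ _ eqs] := sol.
have [cb pbarc] := Qh_piecewise_const Qpbar.
have /choice[cp pc] k := Qh_piecewise_const (discrete_solution_Qh k).
have bm k := Vh_bounded_measurable (discrete_solution_Vh k).
have bmb := Vh_bounded_measurable Vmbar.
have bn k : bounded_measurable (n k) by exact: bounded_measurableB.
have ba := bounded_measurable_coef.
exists (fun k i => cp k i - cb i); split.
- by move=> k i x iN xi; rewrite (pc k i)// (pbarc i).
- move=> k; have [s ms] := Vh_slopes (discrete_solution_Vh k.+1).
  have [sb mbs] := Vh_slopes Vmbar; have sb0 := stationary_slopes mbs.
  exists (fun i => s i - sb i); first exact: has_slopesB.
  have dm := has_slopes_derive1 ms.
  have dp : piecewise_const N (fun i => (cp k.+1 i - cp k i) / tau)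
      (dtau tau p k.+1).
    by move=> i x iN xi; rewrite /dtau /= (pc k.+1 i)// (pc k i).
  pose d i := (cp k.+1 i - cp k i) / tau + s i.
  have dq : piecewise_const N d
      (fun x => dtau tau p k.+1 x + derive1 (m k.+1) x).
    by move=> i x iN xi; rewrite (dp i)// (dm i).
  have [_ _ eqq _] := eqs k.+1 isT.
  have := eqq _ (piecewise_const_Qh N_gt0 dq).
  rewrite (piecewise_const_dot N_gt0 dp dq) (piecewise_const_dot N_gt0 dm dq).
  rewrite -mulrDr -big_split/= => /eqP.
  rewrite mulf_eq0 gt_eqF ?mesh_size_gt0//=.
  under eq_bigr do rewrite -mulrDl.
  rewrite psumr_eq0; last by move=> i _; rewrite -expr2 sqr_ge0.
  move=> /allP d0 i iN; have := d0 (Ordinal iN).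
  rewrite mem_index_enum => /(_ isT).
  rewrite /= mulf_eq0 orbb /d => /eqP di; rewrite sb0// subr0.
  apply/eqP; rewrite -subr_eq0.
  have -> : cp k.+1 i - cb i - (cp k i - cb i) - - tau * s i
    = tau * ((cp k.+1 i - cp k i) / tau + s i) by field; rewrite gt_eqF.
  by rewrite di mulr0.
- move=> k v t Vv vt; have bv := Vh_bounded_measurable Vv.
  have [_ _ _ /(_ v Vv)] := eqs k.+1 isT.
  rewrite -(statv v Vv) => E.
  have dv := has_slopes_derive1 vt.
  rewrite (piecewise_const_dot N_gt0 (pc k.+1) dv) in E.
  rewrite (piecewise_const_dot N_gt0 pbarc dv) in E.
  have Ed : dot (dtau tau m k.+1) v = tau^-1 * (dot (n k.+1) v - dot (n k) v).
    rewrite -dotBl// -dotZl//; last exact: bounded_measurableB.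
    by apply: eq_dot => // x _; rewrite /dtau/=; ring.
  have Ea : dot (fun x => a x * n k.+1 x) v =
      dot (fun x => a x * m k.+1 x) v - dot (fun x => a x * mbar x) v.
    rewrite -dotBl//; try exact: bounded_measurableM.
    by apply: eq_dot => // x _; rewrite mulrBr.
  have Es : \sum_(i < N) (cp k.+1 i - cb i) * t i =
      \sum_(i < N) cp k.+1 i * t i - \sum_(i < N) cb i * t i.
    by rewrite -sumrB; apply: eq_bigr => i _; rewrite mulrBl.
  rewrite Ea Es.
  have En : eps ^+ 2 * (dot (n k.+1) v - dot (n k) v) =
      tau * (eps ^+ 2 * dot (dtau tau m k.+1) v).
    by rewrite Ed; field; rewrite gt_eqF.
  move: E => /eqP; rewrite -subr_eq0 => /eqP E.
  by rewrite En -[RHS](mulr0 tau) -[in RHS]E; ring.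
Qed.

End ErrorEquations.

(** * Real inequalities behind the decay *)

Section Decay.
Variable R : realType.

(** Here e2 and n2 are the squared norms of the errors in p and m, eps2 is the
    square of epsilon, and g is the cross term; since eps2 <= 1 the cross
    term is dominated by the energy. *)
Lemma lyapunov_bounds (delta e2 n2 g eps2 : R) :
  0 <= delta <= 2^-1 -> 0 <= eps2 <= 1 -> 0 <= e2 -> 0 <= n2 ->
  - (n2 + e2) <= 2 * g <= n2 + e2 ->
  (e2 + eps2 * n2) / 4 <= (e2 + eps2 * n2) / 2 - delta * (eps2 * g)
    <= (e2 + eps2 * n2) * (3 / 4).
Proof.
move=> /andP[d0 d1] /andP[p0 p1] e0 n0 /andP[g0 g1].
have eg : 2 * (eps2 * g) <= e2 + eps2 * n2.
  by have := ler_wpM2l p0 g1; have := ler_wpM2r e0 p1; lra.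
have ge : - (e2 + eps2 * n2) <= 2 * (eps2 * g).
  by have := ler_wpM2l p0 g0; have := ler_wpM2r e0 p1; lra.
have E0 : 0 <= e2 + eps2 * n2 by rewrite addr_ge0// mulr_ge0.
have dE := ler_wpM2r E0 d1.
by have := ler_wpM2l d0 eg; have := ler_wpM2l d0 ge; lra.
Qed.

(** One time step, with primes for the previous one, de2 and dn2 for the squared
    norms of the increments, and an for the dissipation.  The identities
    energy and cross come from testing with the error in m and with the
    antiderivative of the error in p.  The second one produces a multiple of
    e2, at the price of terms in n2, absorbed by the dissipation as
    delta * (3 + ahi^2) <= alo, and of a term in dn2, absorbed by the numerical
    dissipation of the implicit Euler scheme as delta * tau <= 1. *)
Lemma lyapunov_step (alo ahi tau0 delta tau eps2 : R)
    (e2 e2' de2 n2 n2' dn2 an g g' q b : R) :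
  0 < delta <= 2^-1 -> delta * tau0 <= 1 -> delta * (3 + ahi ^+ 2) <= alo ->
  0 <= eps2 <= 1 -> 0 < tau <= tau0 ->
  0 <= e2 -> 0 <= de2 -> 0 <= n2 -> 0 <= dn2 ->
  - (n2 + e2) <= 2 * g <= n2 + e2 ->
  alo * n2 <= an -> 2 * q <= 3 * n2 + dn2 -> 2 * b <= ahi ^+ 2 * n2 + e2 ->
  e2 - e2' + de2 + eps2 * (n2 - n2' + dn2) + 2 * (tau * an) = 0 ->
  tau * e2 = eps2 * (g - g') + tau * (eps2 * q) + tau * b ->
  (1 + 2 / 3 * delta * tau) * ((e2 + eps2 * n2) / 2 - delta * (eps2 * g))
    <= (e2' + eps2 * n2') / 2 - delta * (eps2 * g').
Proof.
move=> /andP[d0 d1] dtau0 dalo p01 /andP[t0 t1] e0 de0 n0 dn0 gb.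
move=> an_ge q_le b_le energy cross.
have /andP[p0 p1] := p01.
have d01 : 0 <= delta <= 2^-1 by rewrite ltW.
have /andP[_ F_le] := lyapunov_bounds d01 p01 e0 n0 gb.
have dt0 : 0 <= delta * tau by rewrite mulr_ge0// ltW.
have dt1 : delta * tau <= 1.
  by apply: le_trans dtau0; rewrite ler_wpM2l// ltW.
have H1 := ler_wpM2l dt0 F_le.
have H2 := ler_wpM2l (ltW t0) an_ge.
have H3 : delta * tau * (eps2 * (2 * q))
    <= delta * tau * (eps2 * (3 * n2 + dn2)).
  by apply: ler_wpM2l => //; exact: ler_wpM2l.
have H4 := ler_wpM2l dt0 b_le.
have H5 : delta * tau * (eps2 * dn2) <= eps2 * dn2.
  by rewrite ler_piMl// mulr_ge0.
have tn0 : 0 <= tau * n2 by rewrite mulr_ge0// ltW.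
have H6 := ler_wpM2r tn0 dalo.
have H7 : delta * tau * (eps2 * n2) <= delta * tau * n2.
  by rewrite ler_wpM2l// ler_piMl.
have H8 : delta * tau * e2 = delta * (eps2 * (g - g'))
    + delta * tau * (eps2 * q) + delta * tau * b.
  by rewrite -mulrA cross; ring.
have H9 : 0 <= delta * tau * n2 by rewrite mulr_ge0.
have H10 : 0 <= delta * tau * n2 * ahi ^+ 2 by rewrite mulr_ge0// sqr_ge0.
lra.
Qed.

(** With y = beta tau / (1 + beta tau), the damping factor per step is
    1 - y <= exp(-y), and y is at least gamma tau because tau <= tau0. *)
Lemma implicit_euler_decay (beta tau0 tau : R) (F : nat -> R) :
  0 < beta -> 0 < tau <= tau0 -> (forall k, 0 <= F k) ->
  (forall k, (1 + beta * tau) * F k.+1 <= F k) ->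
  forall j k, (j <= k)%N ->
  F k <= expR (- (beta / (1 + beta * tau0) * (k - j)%:R * tau)) * F j.
Proof.
move=> b0 /andP[t0 t1] F0 Fstep j k /subnKC <-; rewrite addKn.
have bt0 : 0 < beta * tau by rewrite mulr_gt0.
have bt1 : beta * tau <= beta * tau0 by rewrite ler_pM2l.
set gamma := beta / _.
have rate : (1 + beta * tau)^-1 <= expR (- (gamma * tau)).
  have y : gamma * tau <= 1 - (1 + beta * tau)^-1.
    have -> : 1 - (1 + beta * tau)^-1 = beta * tau / (1 + beta * tau).
      by field; rewrite gt_eqF//; lra.
    rewrite /gamma mulrAC ler_pM2l// lef_pV2 ?posrE; lra.
  apply: le_trans (expR_ge1Dx _); lra.
elim: (k - j)%N => [|i IH].
  by rewrite mulr0 mul0r oppr0 expR0 mul1r addn0.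
rewrite addnS -natr1.
have -> : - (gamma * (i%:R + 1) * tau) = - (gamma * tau) - gamma * i%:R * tau.
  by ring.
rewrite expRD -mulrA.
apply: le_trans (ler_wpM2l (expR_ge0 _) IH).
apply: le_trans (ler_wpM2r (F0 _) rate).
rewrite mulrC ler_pdivlMr; last lra.
by rewrite mulrC Fstep.
Qed.

End Decay.

(** * The Lyapunov functional *)

Section Lyapunov.
Variables (R : realType) (a : R -> R) (alo ahi : R).
Hypothesis a_meas : measurable_fun (@I01 R) a.
Hypothesis alo_gt0 : 0 < alo.
Hypothesis a_bounds : forall x : R, @I01 R x -> alo <= a x <= ahi.
Variables (N : nat) (tau0 tau eps delta : R).
Variables (e n : nat -> R -> R) (c : nat -> nat -> R).
Hypothesis N_gt0 : (0 < N)%N.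
Hypothesis tau_bounds : 0 < tau <= tau0.
Hypothesis eps_bounds : 0 <= eps <= 1.
Hypothesis delta_bounds : 0 < delta <= 2^-1.
Hypothesis delta_tau0 : delta * tau0 <= 1.
Hypothesis delta_alo : delta * (3 + ahi ^+ 2) <= alo.
Local Notation h := (mesh_size R N).
Hypothesis e_const : forall k, piecewise_const N (c k) (e k).
Hypothesis n_Vh : forall k, Vh N (n k).
Hypothesis balance : forall k, exists2 s, has_slopes N s (n k.+1) &
  forall i, (i < N)%N -> c k.+1 i - c k i = - tau * s i.
Hypothesis momentum : forall k v t, Vh N v -> has_slopes N t v ->
  eps ^+ 2 * (dot (n k.+1) v - dot (n k) v)
  - tau * (h * \sum_(i < N) c k.+1 i * t i)
  + tau * dot (fun x => a x * n k.+1 x) v = 0.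

Definition energy k : R := dot (e k) (e k) + eps ^+ 2 * dot (n k) (n k).

(** The cross term is what makes the error in p visible to the dissipation,
    which by itself only involves the error in m. *)
Definition lyapunov k : R :=
  energy k / 2 - delta * (eps ^+ 2 * dot (n k) (antideriv N (c k))).

Let bounded_n k : bounded_measurable (n k).
Proof. exact: Vh_bounded_measurable (n_Vh k). Qed.

Let eps2_bounds : 0 <= eps ^+ 2 <= 1.
Proof. by have /andP[? ?] := eps_bounds; rewrite sqr_ge0 expr_le1. Qed.

Let antideriv_le k :
  dot (antideriv N (c k)) (antideriv N (c k)) <= dot (e k) (e k).
Proof.
rewrite (piecewise_const_dot N_gt0 (@e_const k) (@e_const k)).
by have := antideriv_norm_le N_gt0 (c k); under eq_bigr do rewrite expr2.
Qed.

Let cross_bounds k : - (dot (n k) (n k) + dot (e k) (e k))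
  <= 2 * dot (n k) (antideriv N (c k)) <= dot (n k) (n k) + dot (e k) (e k).
Proof.
have bl := bounded_measurable_antideriv N (c k).
have := dot_young (bounded_n k) bl; have := dot_youngN (bounded_n k) bl.
by have := antideriv_le k; lra.
Qed.

Lemma energy_ge0 k : 0 <= energy k.
Proof.
rewrite addr_ge0 ?dot_ge0//; apply: mulr_ge0; [exact: sqr_ge0|exact: dot_ge0].
Qed.

Lemma lyapunov_equiv k : energy k / 4 <= lyapunov k <= energy k * (3 / 4).
Proof.
have /andP[/ltW d0 d1] := delta_bounds.
by apply: lyapunov_bounds; rewrite ?d0 ?dot_ge0.
Qed.

Lemma lyapunov_decrease k :
  (1 + 2 / 3 * delta * tau) * lyapunov k.+1 <= lyapunov k.
Proof.
have [s ns cs] := balance k.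
have ba := bounded_measurable_coef a_meas alo_gt0 a_bounds.
have ban := bounded_measurableM ba (bounded_n k.+1).
have bs := bounded_measurable_antideriv N s.
pose dn x := n k.+1 x - n k x.
(* The two test functions: the error in m, whose coupling with p telescopes
   through the balance equation, and the antiderivative of the error in p. *)
have energy_id := momentum k (n_Vh k.+1) ns.
have cross_id := momentum k (Vh_antideriv N_gt0 (c k.+1))
  (antideriv_slopes N_gt0 (c k.+1)).
apply: (@lyapunov_step _ alo ahi tau0 delta tau (eps ^+ 2) _ _
  (h * \sum_(i < N) (c k.+1 i - c k i) ^+ 2) _ _ (dot dn dn)
  (dot (fun x => a x * n k.+1 x) (n k.+1)) _ _ (dot (n k) (antideriv N s))
  (dot (fun x => a x * n k.+1 x) (antideriv N (c k.+1)))) => //;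
  try exact: dot_ge0.
- rewrite mulr_ge0 ?sumr_ge0//; first by rewrite ltW// mesh_size_gt0.
  by move=> i _; exact: sqr_ge0.
- exact: (coef_dot_ge a_meas alo_gt0 a_bounds).
- apply: le_trans (dot_young_shift (bounded_n k.+1) (bounded_n k) bs) _.
  rewrite lerD2r; move: (antideriv_slopes_le N_gt0 (n_Vh k.+1) ns).
  by move: (dot (antideriv N s) _) (dot (n k.+1) _) => ? ?; lra.
- apply: le_trans (dot_young ban (bounded_measurable_antideriv N (c k.+1))) _.
  by rewrite lerD// (coef_dot_le a_meas alo_gt0 a_bounds).
- have sE : - tau * (h * \sum_(i < N) c k.+1 i * s i) =
      h * \sum_(i < N) c k.+1 i * (c k.+1 i - c k i).
    rewrite mulrCA; congr (_ * _); rewrite mulr_sumr; apply: eq_bigr => i _.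
    by rewrite cs//; ring.
  have eE : dot (e k.+1) (e k.+1) - dot (e k) (e k)
      + h * \sum_(i < N) (c k.+1 i - c k i) ^+ 2 =
      2 * (h * \sum_(i < N) c k.+1 i * (c k.+1 i - c k i)).
    rewrite (piecewise_const_dot N_gt0 (@e_const k.+1) (@e_const k.+1)).
    rewrite (piecewise_const_dot N_gt0 (@e_const k) (@e_const k)).
    rewrite -mulrBr -mulrDr mulrCA; congr (_ * _).
    by rewrite -sumrB -big_split/= mulr_sumr; apply: eq_bigr => i _; ring.
  rewrite eE -sE (dot_sub_sqr (bounded_n k.+1) (bounded_n k)).
  rewrite (dotC (n k.+1) (n k)).
  move: energy_id; move: (dot (n k.+1) _) (dot (n k) _) (dot (n k) _).
  by move: (dot (fun x => a x * _) _) (h * _) => ? ? ? ? ?; lra.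
- (* The increment of the antiderivative is - tau times that of the slopes of
     n, so shifting it in time leaves a product of errors in m only. *)
  have qE : tau * dot (n k) (antideriv N s) =
      dot (n k) (antideriv N (c k)) - dot (n k) (antideriv N (c k.+1)).
    rewrite -dotBr ?bounded_n//; try exact: bounded_measurable_antideriv.
    rewrite -dotZr//; apply: eq_dot => // x _.
    by rewrite -[RHS]opprB (antideriv_comb cs); ring.
  rewrite (piecewise_const_dot N_gt0 (@e_const k.+1) (@e_const k.+1)).
  move/eqP: cross_id; rewrite addrAC subr_eq add0r => /eqP <-.
  have shift (A T q x y z : R) : T * q = y - z ->
      A * (x - z) = A * (x - y) + T * (A * q).
    by move=> Tq; rewrite mulrCA Tq; ring.
  by congr (_ + _); exact: shift.
Qed.

End Lyapunov.

(** * Exponential decay to the stationary state *)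

Theorem theorem4 (R : realType) (a : R -> R) (alo ahi : R)
    (a_meas : measurable_fun (@I01 R) a)
    (alo_gt0 : 0 < alo)
    (a_bounds : forall x : R, @I01 R x -> alo <= a x <= ahi)
    (g0 g1 : R) (p0 m0 : R -> R)
    (p0_H1 : H1 p0) (m0_H1 : H1 m0)
    (p0_0 : p0 0 = g0) (p0_1 : p0 1 = g1)
    (tau0 : R) (tau0_gt0 : 0 < tau0) :
  exists C gamma : R, [/\ 0 < C, 0 < gamma &
    forall (eps : R) (N : nat) (tau : R),
      0 <= eps <= 1 -> (0 < N)%N -> 0 < tau <= tau0 ->
    forall (p m : nat -> R -> R) (pbar mbar : R -> R),
      discrete_solution a g0 g1 p0 m0 N tau eps p m ->
      discrete_stationary_solution a g0 g1 N pbar mbar ->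
    forall j k : nat, (j <= k)%N ->
      error_energy eps (p k) (m k) pbar mbar
      <= C * expR (- (gamma * (k - j)%:R * tau))
           * error_energy eps (p j) (m j) pbar mbar].
Proof.
have c0 : 0 < 3 + ahi ^+ 2 :> R by have := sqr_ge0 ahi; lra.
(* The three conditions on delta: equivalence of the functional with the
   energy, absorption of the time increments, absorption by the dissipation. *)
pose delta := Num.min (2^-1) (Num.min tau0^-1 (alo / (3 + ahi ^+ 2))).
have delta_gt0 : 0 < delta by rewrite !lt_min !invr_gt0 tau0_gt0 ltr0n divr_gt0.
have delta_bounds : 0 < delta <= 2^-1 by rewrite delta_gt0 ge_min lexx.
have delta_tau0 : delta * tau0 <= 1.
  by rewrite -ler_pdivlMr// div1r !ge_min lexx orbT.
have delta_alo : delta * (3 + ahi ^+ 2) <= alo.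
  by rewrite -ler_pdivlMr// !ge_min lexx !orbT.
have beta_gt0 : 0 < 2 / 3 * delta by rewrite mulr_gt0.
exists 3, (2 / 3 * delta / (1 + 2 / 3 * delta * tau0)); split=> //.
  by rewrite divr_gt0// addr_gt0// mulr_gt0.
move=> eps N tau eps_bounds N_gt0 tau_bounds p m pbar mbar sol stat j k jk.
have tau_gt0 : 0 < tau by case/andP: tau_bounds.
have [c [e_const balance momentum]] :=
  error_equations a_meas alo_gt0 a_bounds N_gt0 tau_gt0 sol stat.
have n_Vh i : Vh N (fun x => m i x - mbar x).
  by apply: VhB; [exact: discrete_solution_Vh sol i|case: stat].
set e := fun i x => p i x - pbar x.
set n := fun i x => m i x - mbar x.
have energyE i : error_energy eps (p i) (m i) pbar mbar = energy eps e n i.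
  by rewrite /error_energy !L2norm_sqr.
pose F := lyapunov N eps delta e n c.
have Fb i : energy eps e n i / 4 <= F i <= energy eps e n i * (3 / 4).
  exact: (lyapunov_equiv N_gt0 eps_bounds delta_bounds e_const n_Vh).
have F_ge0 i : 0 <= F i.
  have /andP[+ _] := Fb i; apply: le_trans.
  by rewrite divr_ge0// energy_ge0.
have Fstep i : (1 + 2 / 3 * delta * tau) * F i.+1 <= F i.
  exact: (lyapunov_decrease a_meas alo_gt0 a_bounds N_gt0 tau_bounds eps_bounds
    delta_bounds delta_tau0 delta_alo e_const n_Vh balance momentum).
have := implicit_euler_decay beta_gt0 tau_bounds F_ge0 Fstep jk.
have /andP[Fk _] := Fb k; have /andP[_ Fj] := Fb j.
have := ler_wpM2l (expR_ge0 (- (2 / 3 * delta / (1 + 2 / 3 * delta * tau0) *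
  (k - j)%:R * tau))) Fj.
rewrite !energyE; move: Fk; set X := expR _.
move: X (F k) (F j) (energy _ _ _ k) (energy _ _ _ j) => X Fk' Fj' Ek Ej; lra.
Qed.
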